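(* Writing $n_v(k,g,\lambda)$ for the minimum order of a vertex-girth-regular $(k,g,\lambda)$-graph, the following $29$ upper bounds hold (in particular, vertex-girth-regular graphs with each of these parameters exist): \begin{itemize} \item $n_v(3,7,1)\le 42$, $n_v(3,7,2)\le 42$, $n_v(3,7,4)\le 42$; \item $n_v(3,8,2)\le 60$, $n_v(3,8,5)\le 48$, $n_v(3,8,7)\le 56$; \item $n_v(4,5,1)\le 35$, $n_v(4,5,3)\le 35$, $n_v(4,5,6)\le 30$, $n_v(4,5,7)\le 30$; \item $n_v(4,6,1)\le 72$, $n_v(4,6,2)\le 72$, $n_v(4,6,3)\le 60$, $n_v(4,6,4)\le 60$, $n_v(4,6,5)\le 60$, $n_v(4,6,6)\le 55$, $n_v(4,6,7)\le 60$, $n_v(4,6,8)\le 54$, $n_v(4,6,9)\le 48$, $n_v(4,6,10)\le 51$, $n_v(4,6,11)\le 54$, $n_v(4,6,12)\le 48$, $n_v(4,6,13)\le 48$, $n_v(4,6,14)\le 54$, $n_v(4,6,15)\le 48$, $n_v(4,6,17)\le 54$, $n_v(4,6,19)\le 48$, $n_v(4,6,21)\le 42$, $n_v(4,6,29)\le 42$. \end{itemize} Moreover, seven of these bounds are tight: $n_v(3,7,1)=n_v(3,7,2)=n_v(3,7,4)=42$, $n_v(3,8,5)=48$, $n_v(4,5,1)=35$, and $n_v(4,5,6)=n_v(4,5,7)=30$.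
   Context: Graphs are finite and simple. A $(k,g)$-graph is a $k$-regular graph with girth exactly $g$. A vertex-girth-regular $(k,g,\lambda)$-graph is a $(k,g)$-graph in which every vertex lies on exactly $\lambda$ cycles of length $g$. $n_v(k,g,\lambda)$ is the smallest number of vertices of such a graph (if one exists). The lower bounds $n_v(3,7,\lambda)\ge 42$ for $\lambda\in\{1,2,4\}$, $n_v(3,8,5)\ge 48$, $n_v(4,5,1)\ge 35$, and $n_v(4,5,\lambda)\ge 30$ for $\lambda\in\{6,7\}$ are known from earlier literature and may be used. *)

(* Defs.v *)
From mathcomp Require Import all_boot.

Set Implicit Arguments.
Unset Strict Implicit.
Unset Printing Implicit Defensive.

Record sgraph := SGraph {
  vertex :> finType;
  adj : rel vertex;
  adj_sym : symmetric adj;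
  adj_irrefl : irreflexive adj }.

Definition regular (G : sgraph) (k : nat) : Prop :=
  forall x : G, #|[set y | adj x y]| = k.

(* A cycle is a subgraph, identified with its edge set: the rotations and the
   reversal of a vertex sequence all yield the same cycle. *)
Definition cycle_edges (G : sgraph) (c : seq G) : {set {set G}} :=
  [set [set x; next c x] | x in c].

(* The condition [2 < g] matters: a single edge traversed back and forth
   satisfies [ucycleb] with length 2, as does the empty sequence with length 0. *)
Definition cycles (G : sgraph) (g : nat) : {set {set {set G}}} :=
  [set cycle_edges (c : seq G) | c : g.-tuple G & (2 < g) && ucycleb (@adj G) c].

Definition has_girth (G : sgraph) (g : nat) : Prop :=
  cycles G g != set0 /\ forall h, h < g -> cycles G h = set0.

Definition kg_graph (G : sgraph) (k g : nat) : Prop :=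
  regular G k /\ has_girth G g.

Definition vertex_girth_regular (G : sgraph) (k g l : nat) : Prop :=
  kg_graph G k g /\
  forall v : G, #|[set C in cycles G g | v \in cover C]| = l.

Definition vgr_order (k g l n : nat) : Prop :=
  exists2 G : sgraph, vertex_girth_regular G k g l & #|G| = n.

(* [n_v] is only defined when some (k, g, l)-graph exists, so it is given
   as a relation: [nv_eq k g l n] says that n_v(k, g, l) exists and equals [n]. *)
Definition nv_eq (k g l n : nat) : Prop :=
  vgr_order k g l n /\ forall m, vgr_order k g l m -> n <= m.

(* Includes the existence of n_v(k, g, l). *)
Definition nv_le (k g l N : nat) : Prop :=
  exists2 n, nv_eq k g l n & n <= N.

(* Does not include the existence of n_v(k, g, l). *)
Definition nv_ge (k g l N : nat) : Prop :=
  forall n, nv_eq k g l n -> N <= n.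

(* Main.v *)
(** The upper bounds are witnessed by explicit graphs, found by a randomised computer
    search among the graphs on which a given group acts semiregularly; they are
    recorded modulo a cyclic group of automorphisms. A cycle of length [g] through a
    vertex [v] is represented by the unique sequence that starts at [v], runs along
    the cycle, and has a second vertex smaller than its last one. The number of
    cycles through [v] is therefore the number of such sequences, which is obtained
    by enumerating the simple paths that start at [v]. *)

Require Import Defs.
From mathcomp Require Import all_boot.
From Stdlib Require Import Classical.

Set Implicit Arguments.
Unset Strict Implicit.
Unset Printing Implicit Defensive.

(** * Cycles as edge sets, and their representatives based at a vertex *)

Lemma set2_eqP (T : finType) (x y z w : T) :
  [set x; y] = [set z; w] -> x = z /\ y = w \/ x = w /\ y = z.
Proof.
move=> eq_s.
have xP : x \in [set z; w] by rewrite -eq_s set21.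
have yP : y \in [set z; w] by rewrite -eq_s set22.
have zP : z \in [set x; y] by rewrite eq_s set21.
have wP : w \in [set x; y] by rewrite eq_s set22.
by move: xP yP zP wP {eq_s}; rewrite !inE; do 4![case/orP=> /eqP ?]; subst; auto.
Qed.

Section CycleEdges.

Variable G : sgraph.
Implicit Types (c : seq G) (v x y : G).

(** The edge [[set x; y]] is generated either by [x] itself or by its predecessor on the cycle. *)
Lemma mem_cycle_edges c x y : uniq c -> x \in c ->
  ([set x; y] \in cycle_edges c) = (y == next c x) || (y == prev c x).
Proof.
move=> Uc cx; apply/imsetP/orP=> [[z cz /set2_eqP[[-> ->]|[-> ->]]]|].
- by left.
- by right; rewrite prev_next.
- case=> /eqP->; first by exists x.
  by exists (prev c x); rewrite ?mem_prev // next_prev // setUC.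
Qed.

Lemma cover_cycle_edges c v : (v \in cover (cycle_edges c)) = (v \in c).
Proof.
apply/bigcupP/idP=> [[e /imsetP[x cx ->]]|cv].
  by rewrite !inE => /orP[]/eqP->; rewrite ?mem_next.
by exists [set v; next c v]; rewrite ?set21 //; apply/imsetP; exists v.
Qed.

Lemma cycle_edges_rot n c : uniq c -> cycle_edges (rot n c) = cycle_edges c.
Proof.
move=> Uc; apply/setP=> e; apply/imsetP/imsetP=> -[x cx ->];
  by exists x; rewrite ?next_rot // ?mem_rot // -(mem_rot n).
Qed.

Lemma cycle_edges_rev c : uniq c -> cycle_edges (rev c) = cycle_edges c.
Proof.
move=> Uc; apply/setP=> e; apply/imsetP/imsetP=> -[x cx ->].
  exists (prev c x); first by rewrite mem_prev -mem_rev.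
  by rewrite next_rev // next_prev // setUC.
exists (next c x); first by rewrite mem_rev mem_next.
by rewrite next_rev // prev_next // setUC.
Qed.

(** This is where lengths above 2 matter: the two neighbours of a vertex on its cycle are distinct.
    Rotating [x] to the front reduces the claim to a computation. *)
Lemma next_next_neq c x : uniq c -> 2 < size c -> x \in c ->
  next c (next c x) != x.
Proof.
move=> Uc sz /rot_to[i q def_c].
rewrite -!(next_rot i Uc); rewrite -(rot_uniq i) in Uc; rewrite -(size_rot i) in sz.
case: q => [|y [|z q]] in def_c *; rewrite def_c // in sz Uc *.
case/and3P: Uc; rewrite !inE !negb_or => /and3P[xy xz _] _ _.
by rewrite /= eqxx /= eqxx (eq_sym y x) (negPf xy) eq_sym.
Qed.

Lemma traject_next v p : uniq (v :: p) ->
  rcons p v = traject (next (v :: p)) (next (v :: p) v) (size p).+1.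
Proof. by move=> /cycle_next/= /fpathE; rewrite size_rcons. Qed.

Lemma eq_cycle_next v p q : uniq (v :: p) -> uniq (v :: q) ->
    1 < size p -> size q = size p ->
    cycle_edges (v :: p) = cycle_edges (v :: q) ->
    next (v :: p) v = next (v :: q) v ->
  p = q.
Proof.
move=> Up Uq szp eq_sz eqE eq_v; set f := next _ in eq_v; set h := next _ in eq_v.
(* The induction carries two consecutive iterates, since the vertex just left is needed to exclude a
   step backwards. *)
suff eq_iter i : [/\ iter i f v \in v :: p, iter i h v \in v :: q,
    iter i f v = iter i h v & iter i.+1 f v = iter i.+1 h v].
  apply: (@rcons_injl _ v); rewrite !traject_next // eq_sz.
  rewrite -/f -/h -eq_v; apply: (@eq_from_nth _ (f v)) => [|i];
    rewrite !size_traject // => lti.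
  by rewrite !nth_traject // {2}eq_v -!iterSr; case: (eq_iter i).
elim: i => [|i [fi hi eq_i eq_i1]]; first by rewrite !mem_head.
have fi1 : iter i.+1 f v \in v :: p by rewrite iterS mem_next.
have hi1 : iter i.+1 h v \in v :: q by rewrite iterS mem_next.
have hi2 : f (iter i.+1 f v) = h (iter i.+1 f v); last first.
  by split=> //; rewrite [RHS]iterS -eq_i1.
(* The edge leaving the current vertex along [p] is also an edge of [v :: q], so it leads to the
   successor or the predecessor there. The predecessor is the vertex just left, which
   [next_next_neq] excludes. *)
have := mem_cycle_edges (f (iter i.+1 f v)) Up fi1.
rewrite eqxx eqE eq_i1 mem_cycle_edges // => /orP[/eqP //|/eqP].
rewrite [X in prev _ X]iterS prev_next // -eq_i -eq_i1 => eq_fi.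
by have := next_next_neq Up szp fi; rewrite -/f -iterS eq_fi eqxx.
Qed.

Variables (rank : G -> nat) (g : nat).
Hypotheses (rank_inj : injective rank) (g_gt2 : 2 < g).

(** Fixing the head removes the rotations; comparing the ranks of the two neighbours of [v] selects
    one of the two directions. *)
Definition based v : {set g.-tuple G} :=
  [set c : g.-tuple G | [&& ucycleb (@adj G) c, head v c == v &
                             rank (next c v) < rank (prev c v)]].

Lemma cycle_edges_based v :
  [set C in cycles G g | v \in cover C] =
    [set cycle_edges (c : seq G) | c : g.-tuple G in based v].
Proof.
apply/setP=> C; rewrite inE; apply/andP/imsetP => [[]|[c]].
  case/imsetP=> c; rewrite inE => /andP[_ /andP[cyc Uc]] ->.
  rewrite cover_cycle_edges => cv.
  case: (rot_to cv) => i p def_c.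
  have Uv : uniq (v :: p) by rewrite -def_c rot_uniq.
  have szv : size (v :: p) == g by rewrite -def_c size_rot size_tuple.
  have cyc_v : cycle (@adj G) (v :: p) by rewrite -def_c rot_cycle.
  have <- : cycle_edges (v :: p) = cycle_edges c by rewrite -def_c cycle_edges_rot.
  (* If the rotated sequence runs in the wrong direction, its reversal, rotated back to [v], is the
     representative. *)
  have [lt_np|le_pn] := ltnP (rank (next (v :: p) v)) (rank (prev (v :: p) v)).
    by exists (Tuple szv); rewrite // inE; apply/and3P; split=> //=; apply/andP.
  have vr : v \in rev (v :: p) by rewrite mem_rev mem_head.
  case: (rot_to vr) => j q def_q.
  have Uq : uniq (v :: q) by rewrite -def_q rot_uniq rev_uniq.
  have szq : size (v :: q) == g by rewrite -def_q size_rot size_rev.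
  exists (Tuple szq); last first.
    by rewrite /= -def_q cycle_edges_rot ?rev_uniq // cycle_edges_rev.
  rewrite inE; apply/and3P; split=> //.
    apply/andP; split=> //; rewrite -[tval _]def_q rot_cycle rev_cycle.
    by rewrite (eq_cycle (e' := @adj G)) // => x y; rewrite adj_sym.
  rewrite -[tval _]def_q next_rot ?rev_uniq // prev_rot ?rev_uniq //.
  rewrite next_rev // prev_rev //.
  (* Equal ranks would make the two neighbours of [v] coincide. *)
  rewrite ltn_neqAle le_pn andbT; apply/eqP=> /rank_inj eq_pn.
  have := next_next_neq Uv _ (mem_head v p); rewrite (eqP szv) => /(_ g_gt2).
  by rewrite -eq_pn next_prev ?eqxx.
rewrite inE => /and3P[/andP[cyc Uc] /eqP hd _] ->.
rewrite cover_cycle_edges; split.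
  by apply: imset_f; rewrite inE g_gt2 /ucycleb cyc.
case: c hd {cyc Uc} => [[|x c] /= /eqP sz] hd; first by move: g_gt2; rewrite -sz.
by rewrite hd mem_head.
Qed.

(** The edges at [v] determine its two neighbours on the cycle, the rank condition determines which
    comes first, and [eq_cycle_next] recovers the rest. *)
Lemma cycle_edges_inj v :
  {in based v &, injective (fun c : g.-tuple G => cycle_edges c)}.
Proof.
have baseP (c : g.-tuple G) : c \in based v -> exists p,
    [/\ c = v :: p :> seq G, uniq (v :: p), size p = g.-1 &
        rank (next (v :: p) v) < rank (prev (v :: p) v)].
  rewrite inE; case: c => -[|x p] /= /eqP sz; first by move: g_gt2; rewrite -sz.
  case/and3P=> /andP[_ Up] /eqP eq_x lt_np; rewrite {}eq_x in lt_np Up *.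
  by exists p; split; rewrite // -sz.
move=> c d /baseP[p [def_c Up szp ltp]] /baseP[q [def_d Uq szq ltq]].
rewrite /= def_c def_d => eqE; apply: val_inj; rewrite /= def_c def_d.
congr (_ :: _); apply: (@eq_cycle_next v) => //; rewrite ?szp ?szq ?ltn_predRL //.
have mem_p z : ([set v; z] \in cycle_edges (v :: p)) = _ :=
  mem_cycle_edges z Up (mem_head v p).
have mem_q z : ([set v; z] \in cycle_edges (v :: q)) = _ :=
  mem_cycle_edges z Uq (mem_head v q).
(* Unless the first steps agree, each is the last vertex of the other sequence, and the two rank
   inequalities contradict each other. *)
have /orP[/eqP //|/eqP np] :
    (next (v :: p) v == next (v :: q) v) || (next (v :: p) v == prev (v :: q) v).
  by rewrite -mem_q -eqE mem_p eqxx.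
have /orP[/eqP //|/eqP nq] :
    (next (v :: q) v == next (v :: p) v) || (next (v :: q) v == prev (v :: p) v).
  by rewrite -mem_p eqE mem_q eqxx.
by move: ltp ltq; rewrite np nq => /ltnW; rewrite leqNgt => /negP.
Qed.

Lemma card_cycles_at v :
  #|[set C in cycles G g | v \in cover C]| = #|based v|.
Proof. by rewrite cycle_edges_based (card_in_imset (@cycle_edges_inj v)). Qed.

End CycleEdges.

(** * Enumeration of simple paths and of closed paths *)

Section Paths.

Variables (T : eqType) (nbr : T -> seq T).
Implicit Types (x y : T) (s p : seq T).

(** [s] collects the vertices visited before [x]. The starting vertex is not listed in the results,
    and a branch is cut as soon as it would revisit a vertex. *)
Fixpoint paths d s x : seq (seq T) :=
  if d is d'.+1 then
    flatten [seq [seq y :: p | p <- paths d' (x :: s) y]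
            | y <- [seq y <- nbr x | y \notin x :: s]]
  else [:: [::]].

Lemma mem_paths d s x p :
  (p \in paths d s x) =
  [&& size p == d, path (fun y z => z \in nbr y) x p,
      uniq p & ~~ has (mem (x :: s)) p].
Proof.
elim: d s x p => [|d IHd] s x p /=; first by case: p.
apply/flatten_mapP/idP=> [[y]|].
  rewrite mem_filter => /andP[y_s yx] /mapP[q]; rewrite IHd => /and4P[/eqP<- pq Uq].
  move=> /hasPn q_s ->; rewrite /= eqxx yx pq Uq negb_or y_s /=; apply/andP; split.
    by rewrite andbT; apply/negP=> yq; have := q_s y yq; rewrite /= !inE eqxx.
  by apply/hasPn=> z zq; have := q_s z zq;
    rewrite /= !inE !negb_or => /and3P[_ -> ->].
case: p => // y p /= /and4P[sz /andP[yx py] /andP[yp Up]].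
rewrite negb_or => /andP[y_s /hasPn p_s].
exists y; first by rewrite mem_filter y_s.
apply/mapP; exists p => //; rewrite IHd; apply/and4P; split=> //.
apply/hasPn=> z pz; have := p_s z pz; rewrite /= !inE !negb_or => ->.
by rewrite andbT; apply: contraNneq yp => <-.
Qed.

(** A path determines its first vertex and its tail, so no path is produced twice; hence the length
    of the enumeration is a true count. *)
Lemma uniq_paths d s x : (forall y, uniq (nbr y)) -> uniq (paths d s x).
Proof.
move=> Unbr; elim: d s x => //= d IHd s x.
apply: allpairs_uniq_dep => [|y _|]; rewrite ?filter_uniq //.
by move=> _ _ /allpairsPdep[y [p [_ _ ->]]]
  /allpairsPdep[z [q [_ _ ->]]] /= [-> ->].
Qed.

(** The depth is [g.-1] because the starting vertex [x] belongs to the cycle but is not listed; the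
    filter supplies the closing edge. *)
Definition closed_paths g x : seq (seq T) :=
  [seq p <- paths g.-1 [::] x | x \in nbr (last x p)].

Lemma mem_closed_paths g x p : 0 < g ->
  (p \in closed_paths g x) =
  (size (x :: p) == g) && ucycleb (fun y z => z \in nbr y) (x :: p).
Proof.
case: g => // g _; rewrite mem_filter mem_paths /ucycleb /= rcons_path eqSS.
have -> : has (mem [:: x]) p = (x \in p).
  by rewrite has_sym /= orbF.
by case: (x \in nbr _); case: (size p == g); case: (path _ x p);
  case: (uniq p); case: (x \in p).
Qed.

End Paths.

(** * Graphs given by adjacency tables, and the computable check *)

Section TableGraph.

Variable L : seq (seq nat).
Local Notation n := (size L).
Local Notation nbr := (nth [::] L).

(* The conjunction makes the relation symmetric for every table; it is redundant
   for the tables accepted by [vgr_table]. *)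
Definition table_adj : rel 'I_n :=
  [rel x y : 'I_n | [&& x != y, val y \in nbr x & val x \in nbr y]].

Lemma table_adj_sym : symmetric table_adj.
Proof.
by move=> x y; rewrite /table_adj /= eq_sym; congr (_ && _); rewrite andbC.
Qed.

Lemma table_adj_irrefl : irreflexive table_adj.
Proof. by move=> x; rewrite /table_adj /= eqxx. Qed.

Definition table_graph : sgraph := SGraph table_adj_sym table_adj_irrefl.

Definition regular_table k : bool :=
  all (fun x => [&& size (nbr x) == k, uniq (nbr x) &
    all (fun y => [&& y < n, x != y & x \in nbr y]) (nbr x)]) (iota 0 n).

Definition based_paths g x : seq (seq nat) :=
  [seq p <- closed_paths nbr g x | head x p < last x p].

(** The range [iota 3 (g - 3)] consists of the lengths from 3 to [g - 1]; shorter lengths carry no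
    cycles by the definition of [cycles]. *)
Definition vgr_table k g l : bool :=
  regular_table k &&
  all (fun x => all (fun h => nilp (closed_paths nbr h x)) (iota 3 (g - 3)) &&
                (size (based_paths g x) == l)) (iota 0 n).

Lemma map_val_ord m (s : seq nat) : all (fun i => i < m) s ->
  exists t : seq 'I_m, map val t = s.
Proof.
elim: s => [|i s IHs] /=; first by exists [::].
by case/andP=> lt_im /IHs[t <-]; exists (Ordinal lt_im :: t).
Qed.

Variables (k g l : nat).
Hypothesis ok : regular_table k.

Lemma regular_tableP x : x < n -> [/\ size (nbr x) = k, uniq (nbr x) &
  forall y, y \in nbr x -> [&& y < n, x != y & x \in nbr y]].
Proof.
move=> lt_xn; have := allP ok x; rewrite mem_iota.
move=> /(_ lt_xn)/and3P[/eqP ? ? /allP ?].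
by split.
Qed.

Lemma uniq_nbr x : uniq (nbr x).
Proof.
have [lt_xn|le_nx] := ltnP x n; first by case: (regular_tableP lt_xn).
by rewrite nth_default.
Qed.

Lemma nbr_lt x y : y \in nbr x -> y < n.
Proof.
have [lt_xn|le_nx] := ltnP x n; last by rewrite nth_default.
by case: (regular_tableP lt_xn) => _ _ ok_x /ok_x/and3P[].
Qed.

Lemma table_graph_adj (x y : table_graph) : adj x y = (val y \in nbr x).
Proof.
rewrite /= /table_adj /=; case: (regular_tableP (ltn_ord x)) => _ _ ok_x.
have [/ok_x/and3P[_ neq_xy ->]|] := boolP (val y \in nbr x); last by rewrite andbF.
by rewrite -(inj_eq val_inj) neq_xy.
Qed.

Lemma table_graph_regular : regular table_graph k.
Proof.
move=> x; case: (regular_tableP (ltn_ord x)) => <- Ux ok_x.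
have /map_val_ord[t def_t] : all (fun i => i < n) (nbr x).
  by apply/allP=> y /nbr_lt.
rewrite -def_t size_map -(card_uniqP _); last first.
  by rewrite -(map_inj_uniq val_inj) def_t.
by apply: eq_card => y; rewrite inE table_graph_adj -def_t mem_map //;
  apply: val_inj.
Qed.

Lemma ucycleb_table (c : seq table_graph) :
  ucycleb (@adj table_graph) c = ucycleb (fun y z => z \in nbr y) (map val c).
Proof.
rewrite /ucycleb map_inj_uniq; last exact: val_inj.
congr (_ && _); rewrite cycle_map; apply: eq_cycle => x y.
by rewrite table_graph_adj.
Qed.

(** Every entry is a neighbour of its predecessor on the cycle, hence in range; this allows a closed
    path of numbers to be lifted to vertices of the graph. *)
Lemma ucycleb_lt (c : seq nat) :
  ucycleb (fun y z => z \in nbr y) c -> all (fun i => i < n) c.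
Proof.
case/andP=> cyc _; apply/allP=> y cy.
by have /nbr_lt := prev_cycle cyc cy.
Qed.

Lemma card_based_paths (x : table_graph) : 2 < g ->
  #|[set C in cycles table_graph g | x \in cover C]| = size (based_paths g x).
Proof.
move=> g_gt2; rewrite (@card_cycles_at table_graph (@nat_of_ord n)) //;
  last exact: val_inj.
(* The bijection sends a based tuple to its numerical values with the starting vertex dropped. *)
rewrite cardE -(size_map (fun c : g.-tuple table_graph => behead (map val c))).
apply/perm_size/uniq_perm.
- rewrite map_inj_in_uniq ?enum_uniq // => c d.
  rewrite !mem_enum !inE => /and3P[_ /eqP hc _] /and3P[_ /eqP hd _].
  case: c d hc hd => -[|y p] szp [[|z q] szq] /= hc hd eq_pq; apply: val_inj => //=.
  + by move: szp g_gt2 => /= /eqP <-.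
  + by move: szq g_gt2 => /= /eqP <-.
  + by rewrite hc hd (inj_map val_inj eq_pq).
- by rewrite !filter_uniq // uniq_paths // => y; apply: uniq_nbr.
have g_gt0 : 0 < g by apply: ltn_trans g_gt2.
have rankE (q : seq table_graph) : uniq (x :: q) ->
    (val (next (x :: q) x) < val (prev (x :: q) x)) =
    (head (val x) (map val q) < last (val x) (map val q)).
  (* Since [x] does not occur in [q], its index there is the length of [q], so its predecessor on
     [x :: q] is the last entry; its successor is the head of [q]. *)
  case/andP=> xq _; rewrite prev_nth mem_head (memNindex xq).
  rewrite (last_nth (val x)) size_map -(map_cons val) (nth_map x) //=.
  by case: q xq => [|y q] _ //=; rewrite eqxx.
move=> p; rewrite mem_filter mem_closed_paths //; apply/mapP/idP.
  case=> c; rewrite mem_enum inE => /and3P[]; case: c => -[|y q] szq /=.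
    by move: szq g_gt2 => /= /eqP <-.
  move=> cyc /eqP eq_y; subst y => lt_np ->; rewrite size_map -rankE.
    by rewrite lt_np szq -[_ :: _]/(map val (x :: q)) -ucycleb_table.
  by case/andP: cyc.
case/and3P=> lt_hl szp cyc.
have [q def_p] := map_val_ord (ucycleb_lt cyc).
case: q => // y q in def_p *; case: def_p => /val_inj eq_y def_p; subst y p.
rewrite /= size_map in szp.
exists (Tuple (szp : size (x :: q) == g)) => //.
rewrite mem_enum inE /= eqxx andTb.
rewrite -[_ :: _]/(map val (x :: q)) -ucycleb_table in cyc; rewrite cyc /= rankE //.
by case/andP: cyc.
Qed.

Lemma no_closed_paths h : (forall x, x < n -> closed_paths nbr h x = [::]) ->
  cycles table_graph h = set0.
Proof.
move=> noc; apply/setP=> C; rewrite inE; apply/imsetP=> -[c].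
rewrite inE ucycleb_table => /andP[h_gt2 cyc] _.
case: c cyc => -[|x p] /= szp; first by move: szp h_gt2 => /eqP<-.
move=> cyc; have := noc x (ltn_ord x).
have: map val p \in closed_paths nbr h x.
  by rewrite mem_closed_paths ?(ltn_trans _ h_gt2) // /= size_map szp.
by move=> + eq0; rewrite eq0.
Qed.

End TableGraph.

Lemma vgr_tableP (L : seq (seq nat)) k g l : 2 < g -> 0 < l -> 0 < size L ->
  vgr_table L k g l -> vgr_order k g l (size L).
Proof.
move=> g_gt2 l_gt0 L_gt0 /andP[ok /allP okL].
have {}okL x : x < size L ->
    (forall h, 2 < h < g -> closed_paths (nth [::] L) h x = [::]) /\
    size (based_paths L g x) = l.
  rewrite -[size L]/(0 + size L) => lt_xn.
  move: (okL x); rewrite mem_iota => /(_ lt_xn)/andP[/allP noc /eqP eq_l].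
  split=> // h /andP[lt2h lt_hg]; apply: size0nil; apply/eqP/noc.
  by rewrite mem_iota lt2h subnKC.
exists (table_graph L); last by rewrite card_ord.
have card_l (v : table_graph L) :
  #|[set C in cycles (table_graph L) g | v \in cover C]| = l.
  by rewrite (card_based_paths ok v g_gt2); case: (okL v (ltn_ord v)).
split=> //; split; first exact: table_graph_regular ok.
split=> [|h lt_hg].
  (* Some cycle of length [g] exists because vertex 0 lies on [l > 0] of them. *)
  apply/set0Pn; have := l_gt0; rewrite -(card_l (Ordinal L_gt0)) card_gt0.
  by case/set0Pn=> C; rewrite inE => /andP[gC _]; exists C.
have [lt2h|le_h2] := ltnP 2 h.
  by apply: (no_closed_paths ok) => x lt_xn;
    case: (okL x lt_xn) => noc _; rewrite noc ?lt2h.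
apply/setP=> C; rewrite inE; apply/imsetP=> -[c].
by rewrite inE ltnNge le_h2.
Qed.

(* A cyclic cover: [b] lists the neighbours of the vertices [0 .. size b - 1], and
   the graph is invariant under the translation by [size b] modulo [n]. *)
Definition lift n (b : seq (seq nat)) : seq (seq nat) :=
  [seq [seq (y + v %/ size b * size b) %% n | y <- nth [::] b (v %% size b)]
  | v <- iota 0 n].

(** The cyclic symmetry only compresses the data: the check runs through every vertex of the
    unfolded table. *)
Lemma vgr_lift n b k g l : 2 < g -> 0 < l -> 0 < n ->
  vgr_table (lift n b) k g l -> vgr_order k g l n.
Proof.
have {3}<- : size (lift n b) = n by rewrite size_map size_iota.
by move=> g2 l0 n0; apply: vgr_tableP; rewrite ?size_map ?size_iota.
Qed.

(** * From a witness to the minimum order *)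

Lemma vgr_order_nv_le k g l n : vgr_order k g l n -> nv_le k g l n.
Proof.
elim/ltn_ind: n => n IHn ex_n.
(* The existence of a smaller graph is decided classically: either descend to it, or [n] is already
   the minimum. *)
case: (classic (exists2 m, vgr_order k g l m & m < n)) => [[m ex_m lt_mn]|min_n].
  by have [r eq_r le_rm] := IHn m lt_mn ex_m;
    exists r; rewrite ?(leq_trans le_rm (ltnW lt_mn)).
exists n => //; split=> // m ex_m; rewrite leqNgt; apply/negP=> lt_mn.
by apply: min_n; exists m.
Qed.

(** Lower bounds from the literature enter here, as the hypothesis [nv_ge]. *)
Lemma nv_le_ge_eq k g l n : nv_le k g l n -> nv_ge k g l n -> nv_eq k g l n.
Proof.
case=> m eq_m le_mn ge_n; suff <- : m = n by [].
by apply/eqP; rewrite eqn_leq le_mn ge_n.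
Qed.

(** * The 29 witness graphs *)

Lemma vgr_order_3_7_1 : vgr_order 3 7 1 42.
Proof.
(* Fourteen rows for 42 vertices: the group is generated by translation by 14 and has order 3. The
   remaining tables are read in the same way. *)
apply: (@vgr_lift _
  ([:: [:: 6; 19; 31]; [:: 4; 23; 26]; [:: 9; 13; 25]; [:: 5; 8; 14];
      [:: 1; 7; 19]; [:: 3; 28; 32]; [:: 0; 12; 39]; [:: 4; 8; 24];
      [:: 3; 7; 38]; [:: 2; 26; 29]; [:: 22; 27; 35]; [:: 20; 27; 30];
      [:: 6; 29; 37]; [:: 2; 38; 39]])); only 1-3: by [].
(* The whole check is a boolean evaluated by the virtual machine when the kernel verifies the
   proof. *)
vm_cast_no_check (erefl true).
Qed.

Lemma vgr_order_3_7_2 : vgr_order 3 7 2 42.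
Proof.
apply: (@vgr_lift _
  ([:: [:: 4; 10; 26]; [:: 11; 16; 20]; [:: 17; 27; 29]; [:: 8; 30; 33];
      [:: 0; 6; 21]; [:: 17; 26; 38]; [:: 4; 29; 41]; [:: 32; 36; 39];
      [:: 3; 9; 21]; [:: 8; 27; 40]; [:: 0; 19; 25]; [:: 1; 21; 38];
      [:: 23; 28; 33]; [:: 20; 30; 37]])); only 1-3: by [].
vm_cast_no_check (erefl true).
Qed.

Lemma vgr_order_3_7_4 : vgr_order 3 7 4 42.
Proof.
apply: (@vgr_lift _
  ([:: [:: 4; 26; 27]; [:: 7; 27; 37]; [:: 8; 18; 38]; [:: 10; 18; 19];
      [:: 0; 17; 39]; [:: 11; 34; 41]])); only 1-3: by [].
vm_cast_no_check (erefl true).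
Qed.

Lemma vgr_order_3_8_2 : vgr_order 3 8 2 60.
Proof.
apply: (@vgr_lift _
  ([:: [:: 5; 15; 49]; [:: 4; 12; 50]; [:: 13; 46; 57]; [:: 20; 35; 48];
      [:: 1; 31; 47]; [:: 0; 34; 42]; [:: 7; 29; 31]; [:: 6; 40; 42];
      [:: 33; 45; 51]; [:: 14; 32; 44]; [:: 26; 41; 47]; [:: 28; 34; 39]])); only 1-3: by [].
vm_cast_no_check (erefl true).
Qed.

Lemma vgr_order_3_8_5 : vgr_order 3 8 5 48.
Proof.
(* Translation by 24 is an involution here; exchanging [2i] and [2i+1] is a further automorphism of
   this graph. *)
apply: (@vgr_lift _
  ([:: [:: 15; 43; 46]; [:: 14; 42; 47]; [:: 9; 28; 37]; [:: 8; 29; 36];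
      [:: 6; 26; 43]; [:: 7; 27; 42]; [:: 4; 35; 41]; [:: 5; 34; 40];
      [:: 3; 43; 45]; [:: 2; 42; 44]; [:: 31; 34; 37]; [:: 30; 35; 36];
      [:: 27; 35; 38]; [:: 26; 34; 39]; [:: 1; 36; 39]; [:: 0; 37; 38];
      [:: 21; 31; 41]; [:: 20; 30; 40]; [:: 25; 29; 33]; [:: 24; 28; 32];
      [:: 17; 33; 47]; [:: 16; 32; 46]; [:: 23; 24; 45]; [:: 22; 25; 44]])); only 1-3: by [].
vm_cast_no_check (erefl true).
Qed.

Lemma vgr_order_3_8_7 : vgr_order 3 8 7 56.
Proof.
apply: (@vgr_lift _
  ([:: [:: 2; 4; 28]; [:: 14; 18; 29]; [:: 0; 41; 55]; [:: 5; 6; 38];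
      [:: 0; 32; 47]; [:: 3; 31; 33]; [:: 3; 27; 49]; [:: 10; 20; 37]])); only 1-3: by [].
vm_cast_no_check (erefl true).
Qed.

Lemma vgr_order_4_5_1 : vgr_order 4 5 1 35.
Proof.
apply: (@vgr_lift _
  ([:: [:: 1; 14; 26; 33]; [:: 0; 10; 17; 32]; [:: 4; 6; 14; 21];
      [:: 5; 8; 33; 34]; [:: 2; 8; 25; 27]])); only 1-3: by [].
vm_cast_no_check (erefl true).
Qed.

Lemma vgr_order_4_5_3 : vgr_order 4 5 3 35.
Proof.
apply: (@vgr_lift _
  ([:: [:: 4; 13; 22; 24]; [:: 7; 12; 13; 19]; [:: 15; 18; 26; 31];
      [:: 19; 22; 25; 26]; [:: 0; 15; 21; 23]])); only 1-3: by [].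
vm_cast_no_check (erefl true).
Qed.

Lemma vgr_order_4_5_6 : vgr_order 4 5 6 30.
Proof.
apply: (@vgr_lift _
  ([:: [:: 7; 13; 27; 29]; [:: 6; 16; 18; 22]; [:: 3; 11; 18; 23];
      [:: 2; 12; 20; 29]; [:: 5; 15; 17; 18]; [:: 4; 24; 26; 29];
      [:: 1; 15; 21; 29]; [:: 0; 10; 18; 24]; [:: 21; 22; 24; 27];
      [:: 10; 13; 15; 16]])); only 1-3: by [].
vm_cast_no_check (erefl true).
Qed.

Lemma vgr_order_4_5_7 : vgr_order 4 5 7 30.
Proof.
apply: (@vgr_lift _
  ([:: [:: 2; 7; 9; 12]; [:: 3; 6; 8; 23]; [:: 0; 13; 17; 20]; [:: 1; 11; 22; 26];
      [:: 6; 15; 25; 29]; [:: 7; 14; 18; 24]; [:: 1; 4; 9; 13]; [:: 0; 5; 8; 22];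
      [:: 1; 7; 19; 25]; [:: 0; 6; 14; 28]])); only 1-3: by [].
vm_cast_no_check (erefl true).
Qed.

Lemma vgr_order_4_6_1 : vgr_order 4 6 1 72.
Proof.
apply: (@vgr_lift _
  ([:: [:: 7; 45; 59; 61]; [:: 12; 40; 50; 66]; [:: 25; 28; 29; 71];
      [:: 28; 30; 34; 53]; [:: 37; 45; 50; 51]; [:: 8; 18; 27; 50]])); only 1-3: by [].
vm_cast_no_check (erefl true).
Qed.

Lemma vgr_order_4_6_2 : vgr_order 4 6 2 72.
Proof.
apply: (@vgr_lift _
  ([:: [:: 3; 53; 62; 69]; [:: 10; 15; 26; 56]; [:: 12; 19; 49; 52];
      [:: 0; 6; 29; 61]; [:: 26; 29; 47; 67]; [:: 24; 34; 51; 52]])); only 1-3: by [].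
vm_cast_no_check (erefl true).
Qed.

Lemma vgr_order_4_6_3 : vgr_order 4 6 3 60.
Proof.
apply: (@vgr_lift _
  ([:: [:: 13; 35; 46; 58]; [:: 5; 14; 48; 57]; [:: 4; 16; 31; 49];
      [:: 19; 28; 34; 47]])); only 1-3: by [].
vm_cast_no_check (erefl true).
Qed.

Lemma vgr_order_4_6_4 : vgr_order 4 6 4 60.
Proof.
apply: (@vgr_lift _
  ([:: [:: 3; 22; 23; 24]; [:: 23; 29; 52; 57]; [:: 6; 11; 14; 40];
      [:: 0; 19; 40; 41]; [:: 36; 40; 48; 52]])); only 1-3: by [].
vm_cast_no_check (erefl true).
Qed.

Lemma vgr_order_4_6_5 : vgr_order 4 6 5 60.
Proof.
apply: (@vgr_lift _
  ([:: [:: 14; 22; 31; 47]; [:: 15; 30; 33; 56]; [:: 7; 28; 29; 48];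
      [:: 16; 31; 33; 49]; [:: 17; 38; 42; 51]; [:: 18; 35; 38; 52]])); only 1-3: by [].
vm_cast_no_check (erefl true).
Qed.

Lemma vgr_order_4_6_6 : vgr_order 4 6 6 55.
Proof.
apply: (@vgr_lift _
  ([:: [:: 7; 9; 28; 38]; [:: 13; 19; 34; 42]; [:: 16; 24; 48; 50];
      [:: 12; 20; 30; 46]; [:: 26; 37; 41; 50]])); only 1-3: by [].
vm_cast_no_check (erefl true).
Qed.

Lemma vgr_order_4_6_7 : vgr_order 4 6 7 60.
Proof.
apply: (@vgr_lift _
  ([:: [:: 2; 25; 40; 51]; [:: 35; 36; 56; 58]; [:: 0; 7; 16; 57];
      [:: 8; 12; 35; 40]; [:: 7; 24; 27; 50]; [:: 11; 31; 33; 59]])); only 1-3: by [].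
vm_cast_no_check (erefl true).
Qed.

Lemma vgr_order_4_6_8 : vgr_order 4 6 8 54.
Proof.
apply: (@vgr_lift _
  ([:: [:: 6; 22; 45; 48]; [:: 7; 14; 41; 49]; [:: 5; 39; 43; 51];
      [:: 4; 8; 12; 20]; [:: 3; 5; 17; 36]; [:: 2; 4; 19; 46]])); only 1-3: by [].
vm_cast_no_check (erefl true).
Qed.

Lemma vgr_order_4_6_9 : vgr_order 4 6 9 48.
Proof.
apply: (@vgr_lift _
  ([:: [:: 5; 17; 28; 39]; [:: 16; 26; 28; 35]; [:: 20; 25; 32; 35];
      [:: 12; 16; 21; 33]; [:: 24; 25; 37; 39]; [:: 0; 19; 20; 36]])); only 1-3: by [].
vm_cast_no_check (erefl true).
Qed.

Lemma vgr_order_4_6_10 : vgr_order 4 6 10 51.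
Proof.
apply: (@vgr_lift _
  ([:: [:: 8; 17; 23; 40]; [:: 4; 8; 12; 49]; [:: 30; 36; 45; 46]])); only 1-3: by [].
vm_cast_no_check (erefl true).
Qed.

Lemma vgr_order_4_6_11 : vgr_order 4 6 11 54.
Proof.
apply: (@vgr_lift _
  ([:: [:: 1; 13; 20; 52]; [:: 0; 11; 39; 42]; [:: 10; 27; 36; 39];
      [:: 19; 20; 32; 53]; [:: 6; 23; 35; 50]; [:: 9; 28; 40; 49]])); only 1-3: by [].
vm_cast_no_check (erefl true).
Qed.

Lemma vgr_order_4_6_12 : vgr_order 4 6 12 48.
Proof.
(* A bicirculant on the integers modulo 48: even vertices are joined by steps of 20, odd ones by
   steps of 4, and the two classes by steps of 3, each in both directions. *)
apply: (@vgr_lift _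
  ([:: [:: 3; 20; 28; 45]; [:: 4; 5; 45; 46]])); only 1-3: by [].
vm_cast_no_check (erefl true).
Qed.

Lemma vgr_order_4_6_13 : vgr_order 4 6 13 48.
Proof.
apply: (@vgr_lift _
  ([:: [:: 7; 23; 30; 37]; [:: 6; 20; 38; 47]; [:: 6; 10; 14; 30];
      [:: 7; 11; 15; 47]; [:: 12; 25; 33; 44]; [:: 13; 16; 29; 40];
      [:: 1; 2; 17; 45]; [:: 0; 3; 28; 32]; [:: 11; 21; 43; 44];
      [:: 10; 26; 29; 36]; [:: 2; 9; 31; 41]; [:: 3; 8; 24; 46];
      [:: 4; 20; 24; 39]; [:: 5; 22; 37; 41]; [:: 2; 27; 32; 34];
      [:: 3; 17; 19; 42]])); only 1-3: by [].
vm_cast_no_check (erefl true).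
Qed.

Lemma vgr_order_4_6_14 : vgr_order 4 6 14 54.
Proof.
apply: (@vgr_lift _
  ([:: [:: 17; 29; 45; 51]; [:: 8; 14; 34; 46]; [:: 29; 43; 49; 53];
      [:: 6; 10; 12; 34]; [:: 13; 25; 27; 51]; [:: 8; 30; 32; 42]])); only 1-3: by [].
vm_cast_no_check (erefl true).
Qed.

Lemma vgr_order_4_6_15 : vgr_order 4 6 15 48.
Proof.
apply: (@vgr_lift _
  ([:: [:: 35; 37; 42; 46]; [:: 18; 23; 31; 35]; [:: 8; 20; 28; 33];
      [:: 16; 17; 22; 37]; [:: 6; 15; 26; 34]; [:: 16; 19; 31; 46];
      [:: 4; 8; 13; 35]; [:: 25; 29; 33; 44]])); only 1-3: by [].
vm_cast_no_check (erefl true).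
Qed.

Lemma vgr_order_4_6_17 : vgr_order 4 6 17 54.
Proof.
apply: (@vgr_lift _
  ([:: [:: 25; 31; 39; 40]; [:: 20; 23; 24; 30]; [:: 3; 22; 34; 37];
      [:: 2; 18; 29; 41]; [:: 5; 18; 26; 38]; [:: 4; 21; 33; 37]])); only 1-3: by [].
vm_cast_no_check (erefl true).
Qed.

Lemma vgr_order_4_6_19 : vgr_order 4 6 19 48.
Proof.
apply: (@vgr_lift _
  ([:: [:: 22; 37; 41; 45]; [:: 11; 12; 16; 32]; [:: 11; 19; 28; 39];
      [:: 6; 14; 22; 29]; [:: 26; 30; 33; 37]; [:: 12; 27; 43; 44]])); only 1-3: by [].
vm_cast_no_check (erefl true).
Qed.

Lemma vgr_order_4_6_21 : vgr_order 4 6 21 42.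
Proof.
apply: (@vgr_lift _
  ([:: [:: 3; 28; 31; 34]; [:: 12; 19; 25; 27]; [:: 21; 22; 27; 41];
      [:: 0; 19; 20; 26]; [:: 11; 12; 18; 26]; [:: 8; 23; 29; 40]])); only 1-3: by [].
vm_cast_no_check (erefl true).
Qed.

Lemma vgr_order_4_6_29 : vgr_order 4 6 29 42.
Proof.
apply: (@vgr_lift _
  ([:: [:: 2; 21; 27; 41]; [:: 14; 17; 23; 27]; [:: 0; 16; 28; 31];
      [:: 18; 19; 22; 24]; [:: 11; 20; 27; 32]; [:: 6; 25; 31; 40]])); only 1-3: by [].
vm_cast_no_check (erefl true).
Qed.

Theorem mainTheorem13 :
  (nv_le 3 7 1 42 /\ nv_le 3 7 2 42 /\ nv_le 3 7 4 42 /\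
   nv_le 3 8 2 60 /\ nv_le 3 8 5 48 /\ nv_le 3 8 7 56 /\
   nv_le 4 5 1 35 /\ nv_le 4 5 3 35 /\ nv_le 4 5 6 30 /\ nv_le 4 5 7 30 /\
   nv_le 4 6 1 72 /\ nv_le 4 6 2 72 /\ nv_le 4 6 3 60 /\ nv_le 4 6 4 60 /\
   nv_le 4 6 5 60 /\ nv_le 4 6 6 55 /\ nv_le 4 6 7 60 /\ nv_le 4 6 8 54 /\
   nv_le 4 6 9 48 /\ nv_le 4 6 10 51 /\ nv_le 4 6 11 54 /\ nv_le 4 6 12 48 /\
   nv_le 4 6 13 48 /\ nv_le 4 6 14 54 /\ nv_le 4 6 15 48 /\ nv_le 4 6 17 54 /\
   nv_le 4 6 19 48 /\ nv_le 4 6 21 42 /\ nv_le 4 6 29 42) /\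
  ((nv_ge 3 7 1 42 -> nv_eq 3 7 1 42) /\
   (nv_ge 3 7 2 42 -> nv_eq 3 7 2 42) /\
   (nv_ge 3 7 4 42 -> nv_eq 3 7 4 42) /\
   (nv_ge 3 8 5 48 -> nv_eq 3 8 5 48) /\
   (nv_ge 4 5 1 35 -> nv_eq 4 5 1 35) /\
   (nv_ge 4 5 6 30 -> nv_eq 4 5 6 30) /\
   (nv_ge 4 5 7 30 -> nv_eq 4 5 7 30)).

Proof.
(* All 36 goals, 29 bounds and 7 equalities, reduce to the existence of a graph of the stated
   order. *)
apply: conj; do !apply: conj; try apply: nv_le_ge_eq; apply: vgr_order_nv_le.
- exact: vgr_order_3_7_1.
- exact: vgr_order_3_7_2.
- exact: vgr_order_3_7_4.
- exact: vgr_order_3_8_2.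
- exact: vgr_order_3_8_5.
- exact: vgr_order_3_8_7.
- exact: vgr_order_4_5_1.
- exact: vgr_order_4_5_3.
- exact: vgr_order_4_5_6.
- exact: vgr_order_4_5_7.
- exact: vgr_order_4_6_1.
- exact: vgr_order_4_6_2.
- exact: vgr_order_4_6_3.
- exact: vgr_order_4_6_4.
- exact: vgr_order_4_6_5.
- exact: vgr_order_4_6_6.
- exact: vgr_order_4_6_7.
- exact: vgr_order_4_6_8.
- exact: vgr_order_4_6_9.
- exact: vgr_order_4_6_10.
- exact: vgr_order_4_6_11.
- exact: vgr_order_4_6_12.
- exact: vgr_order_4_6_13.
- exact: vgr_order_4_6_14.
- exact: vgr_order_4_6_15.
- exact: vgr_order_4_6_17.
- exact: vgr_order_4_6_19.
- exact: vgr_order_4_6_21.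
- exact: vgr_order_4_6_29.
(* The seven tight cases use the same graphs again, now combined with the assumed lower bounds. *)
- exact: vgr_order_3_7_1.
- exact: vgr_order_3_7_2.
- exact: vgr_order_3_7_4.
- exact: vgr_order_3_8_5.
- exact: vgr_order_4_5_1.
- exact: vgr_order_4_5_6.
- exact: vgr_order_4_5_7.
Qed.
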